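(* Let $(A,\overline{()},\oplus,\cdot,1)$ be an IMM algebra. The following three statements are equivalent. (i) The equation $(\overline{1}\oplus 1)\cdot x=1$ has a solution $x$ in $A$. (ii) There is a unique unitary ring $(A,+,\cdot,\overline{1},1)$ (that is, a unique addition $+$ on $A$ which, together with the given multiplication $\cdot$, zero element $\overline{1}$ and identity $1$, forms a unitary ring) such that $a+b=(1+1)\cdot(a\oplus b)$ for all $a,b\in A$. (iii) There is a unique unitary ring $(A,+,\cdot,\overline{1},1)$ (in the same sense) such that $a\oplus b=(\overline{1}\oplus 1)\cdot(a+b)$ for all $a,b\in A$.
   Context: An IMM algebra (involutive medial monoid) is a system $(B,\overline{()},\oplus,\cdot,1)$, where $B$ is a set, $\overline{()}$ is a unary operation, $\oplus$ and $\cdot$ are binary operations on $B$ and $1\in B$, such that for all elements of $B$: (B1) $a\oplus a=a$; (B2) $a\oplus b=b\oplus a$; (B3) $(a\oplus b)\oplus(c\oplus d)=(a\oplus c)\oplus(b\oplus d)$; (B4) $a\cdot(b\cdot c)=(a\cdot b)\cdot c$; (B5) $a\cdot 1=a=1\cdot a$; (B6) $a\cdot(b\oplus c)=(a\cdot b)\oplus(a\cdot c)$ and $(a\oplus b)\cdot c=(a\cdot c)\oplus(b\cdot c)$; (B7) $\overline{\overline{a}}=a$; (B8) $\overline{a\oplus b}=\overline{a}\oplus\overline{b}$; (B9) $a\cdot\overline{1}=\overline{1}=\overline{1}\cdot a$; (B10) $\overline{a}\oplus a=\overline{1}\oplus 1$. A unitary ring $(R,+,\cdot,0,1)$ is an associative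 ring with zero $0$ and multiplicative identity $1$, not assumed commutative (and possibly with $0=1$). *)

(* Defs.v *)
From mathcomp Require Import all_boot.

Set Implicit Arguments.
Unset Strict Implicit.
Unset Printing Implicit Defensive.

Declare Scope imm_scope.
Delimit Scope imm_scope with IMM.

Record immAlgebra := ImmAlgebra {
  imm_sort :> Type;
  bar : imm_sort -> imm_sort;
  oplus : imm_sort -> imm_sort -> imm_sort;
  dot : imm_sort -> imm_sort -> imm_sort;
  one : imm_sort;
  oplusxx : forall a, oplus a a = a;
  oplusC : forall a b, oplus a b = oplus b a;
  oplusACA : forall a b c d,
    oplus (oplus a b) (oplus c d) = oplus (oplus a c) (oplus b d);
  dotA : forall a b c, dot a (dot b c) = dot (dot a b) c;
  dotx1 : forall a, dot a one = a;
  dot1x : forall a, dot one a = a;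
  dotDr : forall a b c, dot a (oplus b c) = oplus (dot a b) (dot a c);
  dotDl : forall a b c, dot (oplus a b) c = oplus (dot a c) (dot b c);
  barK : forall a, bar (bar a) = a;
  barD : forall a b, bar (oplus a b) = oplus (bar a) (bar b);
  dotx0 : forall a, dot a (bar one) = bar one;
  dot0x : forall a, dot (bar one) a = bar one;
  oplusNx : forall a, oplus (bar a) a = oplus (bar one) one
}.

Arguments bar {_} _.
Arguments oplus {_} _ _.
Arguments dot {_} _ _.
Arguments one {_}.

Notation "a (+) b" := (oplus a b) : imm_scope.
Notation "a * b" := (dot a b) : imm_scope.
Notation "1" := one : imm_scope.

(* Unlike pzRingType, this puts no choice structure on the carrier and keeps  *)
(* the operations as parameters, so that one can quantify over the addition   *)
(* alone. Multiplication need not commute, and zero = e is allowed.           *)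
Record unitary_ring (R : Type) (add mul : R -> R -> R) (zero e : R) : Prop :=
  UnitaryRing {
    ur_addA : associative add;
    ur_addC : commutative add;
    ur_add0 : left_id zero add;
    ur_addN : forall a, exists b, add b a = zero;
    ur_mulA : associative mul;
    ur_mul1l : left_id e mul;
    ur_mul1r : right_id e mul;
    ur_mulDl : left_distributive mul add;
    ur_mulDr : right_distributive mul add
  }.

(* Main.v *)
(* Write 0 for bar 1. The element h = 0 (+) 1 satisfies h * a = 0 (+) a =     *)
(* a * h, so it is central and plays the role of 1/2; if h * x = 1, then x is *)
(* its inverse, a + b = x * (a (+) b) is the wanted addition, and bar a is    *)
(* 1 - a, so that bar x = -1. Conversely, in (ii) the element 1 + 1 inverts h *)
(* because 0 + 1 = 1, and in (iii) because 1 (+) 1 = 1.                       *)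
Require Import Defs.
From mathcomp Require Import all_boot.
From Stdlib Require Import FunctionalExtensionality.

Local Open Scope imm_scope.

(** Statement (i) is the hub: (ii) and (iii) are each equivalent to it. For existence, the same sum
    [x * (a (+) b)] serves both. Uniqueness holds because [bar 1 (+) 1] can be cancelled, so [(+)]
    determines the addition. *)

Lemma half_dot (A : immAlgebra) (a : A) : (bar 1 (+) 1) * a = bar 1 (+) a.
Proof. by rewrite dotDl dot0x dot1x. Qed.

Lemma dot_half (A : immAlgebra) (a : A) : a * (bar 1 (+) 1) = bar 1 (+) a.
Proof. by rewrite dotDr dotx0 dotx1. Qed.

Lemma half_central (A : immAlgebra) (a : A) :
  (bar 1 (+) 1) * a = a * (bar 1 (+) 1).
Proof. by rewrite half_dot dot_half. Qed.

Section HalfInverse.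

Variables (A : immAlgebra) (x : A).
Hypothesis hx : (bar 1 (+) 1) * x = 1.

Lemma inv_half_dot (a : A) : x * ((bar 1 (+) 1) * a) = a.
Proof. by rewrite dotA -half_central hx dot1x. Qed.

Lemma half_dot_inv (a : A) : (bar 1 (+) 1) * (x * a) = a.
Proof. by rewrite dotA hx dot1x. Qed.

Lemma inv_half_central (a : A) : x * a = a * x.
Proof.
by rewrite -{1}[a]dotx1 -hx [a * _]dotA -half_central -dotA inv_half_dot.
Qed.

Definition imm_add (a b : A) : A := x * (a (+) b).

Lemma imm_addC : commutative imm_add.
Proof. by move=> a b; rewrite /imm_add oplusC. Qed.

(* Factor x out of the sum with c = x * (h * c), then use mediality. *)
Lemma imm_addA : associative imm_add.
Proof.
suff sumE a b c : imm_add (imm_add a b) c = x * (x * ((bar 1 (+) c) (+) (a (+) b))).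
  by move=> a b c; rewrite imm_addC !sumE [b (+) c]oplusC oplusACA.
by rewrite /imm_add -{1}[c]inv_half_dot -dotDr half_dot oplusC.
Qed.

Lemma imm_add_unitary_ring : unitary_ring imm_add dot (bar 1) 1.
Proof.
split.
- exact: imm_addA.
- exact: imm_addC.
- by move=> a; rewrite /imm_add -half_dot inv_half_dot.
(* [bar x] acts as -1: [bar x (+) 1] is the bar of [(bar 1 (+) 1) * x], hence zero. *)
- move=> a; exists (bar x * a).
  have barx : bar x (+) 1 = bar 1 by rewrite -[in LHS](barK 1) -barD oplusC -half_dot hx.
  by rewrite /imm_add -{2}[a]dot1x -dotDl barx dot0x dotx0.
- exact: dotA.
- exact: dot1x.
- exact: dotx1.
- by move=> a b c; rewrite /imm_add -dotA dotDl dotDr.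
- by move=> a b c; rewrite /imm_add dotA -inv_half_central -dotA dotDr.
Qed.

(** Idempotence identifies [x] with the coefficient 1 + 1 in (ii). *)
Lemma imm_add11 : imm_add 1 1 = x.
Proof. by rewrite /imm_add oplusxx dotx1. Qed.

Lemma imm_add_unique (add : A -> A -> A) :
  (forall a b, a (+) b = (bar 1 (+) 1) * add a b) -> imm_add = add.
Proof.
move=> addE; apply: functional_extensionality => a.
by apply: functional_extensionality => b; rewrite /imm_add addE inv_half_dot.
Qed.

End HalfInverse.

Lemma half_dot_add11 {A : immAlgebra} {add : A -> A -> A} :
    unitary_ring add dot (bar 1) 1 ->
    (forall a b, add a b = add 1 1 * (a (+) b)) ->
  (bar 1 (+) 1) * add 1 1 = 1.
Proof. by move=> ringA addE; rewrite half_central -addE (ur_add0 ringA). Qed.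

Theorem theorem5p2 (A : immAlgebra) :
  let i := exists x : A, (bar 1 (+) 1) * x = 1 in
  let ii := exists! add : A -> A -> A,
    unitary_ring add dot (bar 1) 1 /\
    (forall a b : A, add a b = add 1 1 * (a (+) b)) in
  let iii := exists! add : A -> A -> A,
    unitary_ring add dot (bar 1) 1 /\
    (forall a b : A, a (+) b = (bar 1 (+) 1) * add a b) in
  (i <-> ii) /\ (ii <-> iii) /\ (i <-> iii).
Proof.
move=> i ii iii.
have i_ii : i <-> ii.
  split=> [[x hx] | [add [[ringA addE] _]]].
    exists (imm_add A x); split=> [|add [ringA addE]].
      by split=> [|a b]; [exact: imm_add_unitary_ring | rewrite imm_add11].
    (* The competing [add 1 1] also inverts [bar 1 (+) 1], so the equation of (ii) turns into that
       of (iii). *)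
    apply: imm_add_unique => // a b.
    by rewrite addE dotA (half_dot_add11 ringA addE) dot1x.
  by exists (add 1 1); apply: half_dot_add11.
have i_iii : i <-> iii.
  split=> [[x hx] | [add [[_ addE] _]]].
    exists (imm_add A x); split=> [|add [_ addE]]; last exact: imm_add_unique.
    by split=> [|a b]; [exact: imm_add_unitary_ring | rewrite half_dot_inv].
  by exists (add 1 1); rewrite -addE oplusxx.
tauto.
Qed.
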